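(* Let $\mathcal{D}\subset\mathbb{C}$ be a nonempty domain enclosed by a Jordan curve. Consider the following meromorphic functions (sharing their poles) for $1\le i\le s$: $$f_i(z)=\sum_{j=1}^m\frac{w_{ij}}{z-\lambda_j}+h_i(z)\quad\text{and}\quad r_i(z)=\sum_{j=1}^m\frac{\widehat w_{ij}}{z-\widehat\lambda_j}+\widehat h_i(z),$$ where $\lambda_j,\widehat\lambda_j\in\mathcal{D}$ for $1\le j\le m$, the $\lambda_1,\dots,\lambda_m$ are pairwise distinct and each $\lambda_j$ is a pole of at least one $f_i$ (i.e. for every $j$ there is $i$ with $w_{ij}\ne0$), and $h_i,\widehat h_i$ are holomorphic in a neighborhood of the closure of $\mathcal{D}$. Let $\mathcal{F}(z)=[f_1(z),\dots,f_s(z)]^{\mathsf T}$ and $\mathcal{R}(z)=[r_1(z),\dots,r_s(z)]^{\mathsf T}$. Denote the node polynomials by $$p(t)=\prod_{j=1}^m(t-\lambda_j)=\sum_{j=0}^m p_jt^j\quad\text{and}\quad\widehat p(t)=\prod_{j=1}^m(t-\widehat\lambda_j)=\sum_{j=0}^m\widehat p_jt^j.$$ If $\varepsilon:=\max_{z\in\partial\mathcal{D}}\|\mathcal{F}(z)-\mathcal{R}(z)\|$ is sufficiently small, then $$\|\mathbf{p}-\widehat{\mathbf{p}}\|=\mathcal{O}(\varepsilon),\quad\text{where}\quad\mathbf{p}=[p_0,\dots,p_m]^{\mathsf T}\ \text{and}\ \widehat{\mathbf{p}}=[\widehat p_0,\dots,\widehat p_m]^{\mathsf T}.$$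
   Context: $\|\cdot\|$ is the Euclidean norm of a vector. The smallness threshold for $\varepsilon$ and the constant hidden in $\mathcal{O}(\varepsilon)$ (where $a=\mathcal{O}(b)$ means $|a|\le c|b|$ for a positive constant $c$) may depend on $\mathcal{D}$ and $\mathcal{F}$ but not on $\mathcal{R}$. *)

(* Defs.v *)
From HB Require Import structures.
From mathcomp Require Import all_boot all_order all_algebra complex.
From mathcomp Require Import all_classical all_reals all_analysis.

Set Implicit Arguments.
Unset Strict Implicit.
Unset Printing Implicit Defensive.

Import Order.TTheory GRing.Theory Num.Theory.
Import numFieldNormedType.Exports.

Local Open Scope classical_set_scope.
Local Open Scope ring_scope.

(* [R[i]] carries no topology by itself; seen as the carrier of a
   [numClosedFieldType] it inherits the topology of its norm, and it is a
   normed module over itself. *)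
Definition Cplx (R : realType) : numClosedFieldType := complex R.

Definition cmod (R : realType) (z : Cplx R) : R :=
  ComplexField.Normc.normc z.

Definition enorm (R : realType) (n : nat) (v : 'cV[Cplx R]_n) : R :=
  Num.sqrt (\sum_(i < n) cmod (v i ord0) ^+ 2).

Definition frontier (T : topologicalType) (A : set T) : set T :=
  closure A `\` A°.

Definition domain (T : topologicalType) (A : set T) : Prop :=
  open A /\ connected A.

Definition jordan_curve (R : realType) (J : set (Cplx R)) : Prop :=
  exists g : R -> Cplx R,
    [/\ {within `[0, 1]%classic, continuous g},
        g 0 = g 1,
        {in `[0, 1[%classic &, injective g} &
        J = g @` `[0, 1]%classic].

(* By the Jordan curve theorem the complement of [J] has exactly one bounded
   connected component, and the frontier of that component is [J]. *)
Definition enclosed_by (R : realType) (D J : set (Cplx R)) : Prop :=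
  bounded_set D /\ (exists2 z, ~ J z & D = connected_component (~` J) z).

(* Derivability in the direction 1 is complex differentiability, since the
   scalar field of the normed module [Cplx R] is [Cplx R] itself. *)
Definition holomorphic_near (R : realType) (A : set (Cplx R))
    (h : Cplx R -> Cplx R) : Prop :=
  exists U : set (Cplx R),
    [/\ open U, A `<=` U & forall z, U z -> derivable h z 1].

(* The value is meaningful only off the points [lambda j]. *)
Definition meromorphic_vec (R : realType) (s m : nat) (w : 'M[Cplx R]_(s, m))
    (lambda : 'I_m -> Cplx R) (h : 'I_s -> Cplx R -> Cplx R) (z : Cplx R) :
    'cV[Cplx R]_s :=
  \col_(i < s) (\sum_(j < m) w i j / (z - lambda j) + h i z).

Definition node_poly (R : realType) (m : nat) (lambda : 'I_m -> Cplx R) :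
    {poly Cplx R} :=
  \prod_(j < m) ('X - (lambda j)%:P).

Definition coef_vec (R : realType) (m : nat) (p : {poly Cplx R}) :
    'cV[Cplx R]_m.+1 :=
  \col_(j < m.+1) p`_j.

Definition is_max (R : realType) (A : set R) (x : R) : Prop :=
  A x /\ ubound A x.

(* Main.v *)
Require Import Defs.
From HB Require Import structures.
From mathcomp Require Import all_boot all_order all_algebra complex.
From mathcomp Require Import all_classical all_reals all_analysis.
From mathcomp Require Import ring lra.

(* Multiply [f_i - r_i] by [p * p'], where [p'] is the node polynomial of the
   perturbed poles.  The product is holomorphic near the closure of [D] and
   O(eps) on the frontier, hence O(eps) at [lambda j] by the maximum modulus
   principle.  There it equals [p'(lambda j)] times the nonzero constant
   [w i j * \prod_(k != j) (lambda j - lambda k)], so [p'(lambda j) = O(eps)].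
   Since [p' - p] has degree less than [m] and takes the values [p'(lambda j)],
   Lagrange interpolation bounds its coefficients.

   The maximum modulus principle rests on Goursat's theorem for squares.  A
   Cauchy estimate with an arbitrary constant suffices, as the constant
   disappears when the estimate is applied to large powers. *)

Set Implicit Arguments.
Unset Strict Implicit.
Unset Printing Implicit Defensive.

Import Order.TTheory GRing.Theory Num.Theory.
Import numFieldNormedType.Exports.

Local Open Scope classical_set_scope.
Local Open Scope ring_scope.

Local Notation "x %:rc" := (real_complex_def (Phant _) x : Cplx _)
  (at level 2, format "x %:rc").
Local Notation Re := complex.Re.
Local Notation Im := complex.Im.

(** * Modulus and topology of the complex numbers *)

Section Modulus.
Variable R : realType.
Local Notation C := (Cplx R).
Implicit Types (x y z a : C) (t : R).

Lemma norm_cmod z : `|z| = (cmod z)%:rc.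
Proof. by []. Qed.

Lemma cmod_ge0 z : 0 <= cmod z.
Proof. by rewrite -(@lecR R) -norm_cmod normr_ge0. Qed.

Lemma cmodM x y : cmod (x * y) = cmod x * cmod y.
Proof. exact: ComplexField.Normc.normcM. Qed.

Lemma cmodV x : cmod x^-1 = (cmod x)^-1.
Proof. exact: ComplexField.Normc.normcV. Qed.

Lemma cmod0 : cmod (0 : C) = 0.
Proof. exact: ComplexField.Normc.normc0. Qed.

Lemma cmod1 : cmod (1 : C) = 1.
Proof. exact: ComplexField.Normc.normc1. Qed.

Lemma cmodN x : cmod (- x) = cmod x.
Proof. exact: normcN. Qed.

Lemma cmodD x y : cmod (x + y) <= cmod x + cmod y.
Proof. exact: le_normcD. Qed.

Lemma cmodX x n : cmod (x ^+ n) = cmod x ^+ n.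
Proof. by elim: n => [|n IH]; rewrite ?expr0 ?cmod1// !exprS cmodM IH. Qed.

Lemma cmod_eq0 z : (cmod z == 0) = (z == 0).
Proof.
apply/eqP/eqP => [|->]; last exact: cmod0.
exact: ComplexField.Normc.eq0_normc.
Qed.

Lemma cmod_gt0 z : (0 < cmod z) = (z != 0).
Proof. by rewrite lt_def cmod_eq0 cmod_ge0 andbT. Qed.

Lemma cmodB x y : cmod (x - y) <= cmod x + cmod y.
Proof. by rewrite -(cmodN y) cmodD. Qed.

Lemma cmod_distC x y : cmod (x - y) = cmod (y - x).
Proof. by rewrite -cmodN opprB. Qed.

Lemma cmod_sum (I : Type) (r : seq I) (P : pred I) (F : I -> C) :
  cmod (\sum_(i <- r | P i) F i) <= \sum_(i <- r | P i) cmod (F i).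
Proof.
elim/big_rec2: _ => [|i y z _ IH]; first by rewrite cmod0.
by rewrite (le_trans (cmodD _ _))// lerD2l.
Qed.

Lemma cmod_prod (I : Type) (r : seq I) (P : pred I) (F : I -> C) :
  cmod (\prod_(i <- r | P i) F i) = \prod_(i <- r | P i) cmod (F i).
Proof.
by elim/big_rec2: _ => [|i y z _ <-]; rewrite ?cmod1// cmodM.
Qed.

Lemma cmod_sqr z : cmod z ^+ 2 = Re z ^+ 2 + Im z ^+ 2.
Proof. by case: z => a b; rewrite /cmod /= sqr_sqrtr// addr_ge0// sqr_ge0. Qed.

Lemma cmod_rc t : cmod t%:rc = `|t|.
Proof. by rewrite /cmod /= expr0n /= addr0 sqrtr_sqr. Qed.

Lemma cmod_i : cmod ('i%C : C) = 1.
Proof. by rewrite /cmod /= expr0n /= add0r expr1n sqrtr1. Qed.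

Lemma le_Re_cmod z : `|Re z| <= cmod z.
Proof.
rewrite -(ler_pXn2r (n := 2)) ?nnegrE ?cmod_ge0// cmod_sqr real_normK ?num_real//.
by rewrite lerDl sqr_ge0.
Qed.

Lemma le_Im_cmod z : `|Im z| <= cmod z.
Proof.
rewrite -(ler_pXn2r (n := 2)) ?nnegrE ?cmod_ge0// cmod_sqr real_normK ?num_real//.
by rewrite lerDr sqr_ge0.
Qed.

Lemma cmod_le_ReIm z : cmod z <= `|Re z| + `|Im z|.
Proof.
rewrite -(ler_pXn2r (n := 2)) ?nnegrE ?cmod_ge0 ?addr_ge0// cmod_sqr.
rewrite sqrrD !real_normK ?num_real//.
have := mulr_ge0 (normr_ge0 (Re z)) (normr_ge0 (Im z)).
by lra.
Qed.

Lemma cReD x y : Re (x + y) = Re x + Re y.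
Proof. by case: x y => [? ?] [? ?]. Qed.
Lemma cImD x y : Im (x + y) = Im x + Im y.
Proof. by case: x y => [? ?] [? ?]. Qed.
Lemma cReN x : Re (- x) = - Re x.
Proof. by case: x => [? ?]. Qed.
Lemma cImN x : Im (- x) = - Im x.
Proof. by case: x => [? ?]. Qed.
Lemma cReM x y : Re (x * y) =
  Re x * Re y - Im x * Im y.
Proof. by case: x y => [? ?] [? ?]. Qed.
Lemma cImM x y : Im (x * y) =
  Re x * Im y + Im x * Re y.
Proof. by case: x y => [? ?] [? ?]. Qed.

Lemma cplx_ext x y : Re x = Re y ->
  Im x = Im y -> x = y.
Proof. by case: x y => [? ?] [? ?] /= -> ->. Qed.

(** The norm of [C] takes its values in [C]. A positive radius there is real, so neighbourhoods can
    be described by real radii and [cmod]. *)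
Lemma nbhs_cmodP x (A : set C) :
  nbhs x A <-> exists2 e : R, 0 < e & forall y, cmod (y - x) < e -> A y.
Proof.
split.
  move=> /nbhs_normP[e /= e0 xA].
  have eR : e = (Re e)%:rc.
    by rewrite RRe_real// gtr0_real.
  exists (Re e); first by rewrite -(@ltcR R) -eR.
  move=> y yx; apply: xA => /=.
  by rewrite distrC norm_cmod eR ltcR.
move=> [e e0 xA]; apply/nbhs_normP; exists e%:rc => /=; first by rewrite ltcR.
by move=> y /=; rewrite distrC norm_cmod ltcR; exact: xA.
Qed.

Lemma lipschitz_cmod_continuous (f : C -> R) :
  (forall x y, `|f x - f y| <= cmod (x - y)) -> continuous f.
Proof.
move=> fL x A /nbhs_normP[e e0 H]; apply/nbhs_cmodP; exists e => // y xy.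
by apply: H; apply: le_lt_trans (fL _ _) _; rewrite cmod_distC.
Qed.

Lemma continuous_cmod : continuous (@cmod R).
Proof.
apply: lipschitz_cmod_continuous => x y; rewrite ler_norml; apply/andP; split.
  have := cmodD (y - x) x; rewrite subrK cmod_distC; lra.
have := cmodD (x - y) y; rewrite subrK; lra.
Qed.

Lemma continuous_Re : continuous (@Re R : C -> R).
Proof.
by apply: lipschitz_cmod_continuous => x y; rewrite -cReN -cReD le_Re_cmod.
Qed.

Lemma continuous_Im : continuous (@Im R : C -> R).
Proof.
by apply: lipschitz_cmod_continuous => x y; rewrite -cImN -cImD le_Im_cmod.
Qed.

Lemma continuous_line z v : continuous (fun t => z + t%:rc * v : C).
Proof.
move=> t A /nbhs_cmodP[e e0 H].
have v0 : 0 < cmod v + 1 by rewrite ltr_wpDl// cmod_ge0.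
apply/(@nbhs_normP _ R); exists (e / (cmod v + 1)) => /=; first by rewrite divr_gt0.
move=> u /=; rewrite ltr_pdivlMr// => ut; apply: H.
have -> : z + u%:rc * v - (z + t%:rc * v) = (u - t)%:rc * v.
  by rewrite rmorphB; ring.
rewrite cmodM cmod_rc distrC; apply: le_lt_trans ut.
by rewrite ler_wpM2l// lerDl.
Qed.

Lemma continuous_ReIm : continuous (fun p : R * R => Complex p.1 p.2 : C).
Proof.
move=> [s t] A /nbhs_cmodP[e e0 H]; apply/nbhs_ballP.
exists (e / 2) => /=; first by rewrite divr_gt0.
move=> [u v] [/= us vt]; apply: H; apply: le_lt_trans (cmod_le_ReIm _) _ => /=.
move: us vt; rewrite /ball/= /ball_/= !(distrC _ u, distrC _ v); lra.
Qed.

(** The closure is a closed subset of the image of a compact real square under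
    [(s, t) |-> s + i t]. *)
Lemma compact_closure_bounded (A : set C) : bounded_set A -> compact (closure A).
Proof.
move=> [M [Mreal bA]].
have [r HA] : exists r : R, forall z, A z -> cmod z <= r.
  exists (Re M + 1) => z Az.
  have : M < (Re M + 1)%:rc.
    by rewrite -{1}(RRe_real Mreal) ltcR ltrDl.
  by move=> /bA/(_ z Az) /=; rewrite norm_cmod lecR.
set K := (fun p : R * R => Complex p.1 p.2 : C) @` (`[-r, r] `*` `[-r, r]).
have cK : compact K.
  apply: continuous_compact.
    by apply: continuous_subspaceT; exact: continuous_ReIm.
  by apply: compact_setX; exact: segment_compact.
apply: (subclosed_compact (@closed_closure _ _) cK).
rewrite closureE; apply: smallest_sub; first by apply: compact_closed cK; exact: norm_hausdorff.
move=> z /HA zr; exists (Re z, Im z); last by case: (z).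
have := le_trans (le_Re_cmod z) zr; have := le_trans (le_Im_cmod z) zr.
by rewrite !ler_norml => ? ?; split; rewrite /= in_itv.
Qed.

End Modulus.

(** * Integrals along segments *)

Section SegmentIntegral.
Variable R : realType.
Local Notation C := (Cplx R).
Local Notation mu := (@lebesgue_measure R).
Implicit Types (f : C -> C) (g : R -> C) (z v a : C) (l h k t : R).

(** The second piece is moved back to start at 0 by the substitution [t |-> h + t], since every
    segment is parametrised from 0. *)
Lemma Rintegral_segmentD (u : R -> R) h k : 0 <= h -> 0 <= k ->
  {within `[0, h + k], continuous u} ->
  \int[mu]_(t in `[0, h + k]) u t =
  \int[mu]_(t in `[0, h]) u t + \int[mu]_(t in `[0, k]) u (h + t).
Proof.
move=> h0 k0 cu.
have iu : mu.-integrable `[0, h + k] (EFin \o u).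
  by apply: continuous_compact_integrable => //; exact: segment_compact.
have := Rintegral_itvB (x := h) iu.
rewrite !bnd_simp lerDl => /(_ h0 k0)/(canRL (subrK _)) ->.
rewrite addrC; congr (_ + _).
have cu' : {within `[h + 0, h + k], continuous u}.
  apply: continuous_subspaceW cu => x /=; rewrite !in_itv /=; lra.
rewrite Rintegral_itv_obnd_cbnd; last first.
  apply: integrableS iu => // x /=; rewrite !in_itv/=; lra.
have dF x : is_derive x (1:R) (fun t : R => h + t) 1.
  rewrite -[X in is_derive _ _ _ X]add0r.
  by apply: is_deriveD.
have F' : ((fun t : R => h + t)^`())%classic = cst 1.
  by apply/funext => x; rewrite derive1E; exact: derive_val.
have cF : continuous (fun t : R => h + t).
  by move=> x; apply: cvgD; [exact: cvg_cst|exact: cvg_id].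
rewrite /Rintegral; congr fine; rewrite -{1}(addr0 h).
rewrite (@integration_by_substitution_increasing _ (fun t => h + t) u 0 k)//.
- by apply: eq_integral => x _; rewrite F' /= mulr1.
- by move=> x y _ _; rewrite ltrD2l.
- by move=> x _; rewrite F'; exact: cst_continuous.
- by rewrite F'; exact: is_cvg_cst.
- by rewrite F'; exact: is_cvg_cst.
- split => //.
  + by apply: cvg_at_right_filter; exact: cF.
  + by apply: cvg_at_left_filter; exact: cF.
Qed.

Definition seg_continuous l g : Prop :=
  {within `[0, l], continuous (fun t => Re (g t))} /\
  {within `[0, l], continuous (fun t => Im (g t))}.

(** Working componentwise reduces everything to real Lebesgue integrals. The position and direction
    of a segment are carried by the integrand. *)
Definition cint l g : C :=
  Complex (\int[mu]_(t in `[0, l]) Re (g t))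
          (\int[mu]_(t in `[0, l]) Im (g t)).

Lemma seg_integrable l (u : R -> R) : {within `[0, l], continuous u} ->
  mu.-integrable `[0, l] (EFin \o u).
Proof. by apply: continuous_compact_integrable; exact: segment_compact. Qed.

Lemma seg_continuous_line f z v l :
  (forall t, 0 <= t <= l -> {for z + t%:rc * v, continuous f}) ->
  seg_continuous l (fun t => f (z + t%:rc * v)).
Proof.
move=> fc; have H t : t \in `[0, l] ->
    {for t, continuous (fun t => f (z + t%:rc * v))}.
  rewrite in_itv /= => /fc ft.
  exact: (@continuous_comp _ _ _ (fun t : R => z + t%:rc * v) f t
    (@continuous_line R z v t) ft).
split; apply: continuous_in_subspaceT => t /set_mem /H ft.
  exact: continuous_comp ft (@continuous_Re R _).
exact: continuous_comp ft (@continuous_Im R _).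
Qed.

Lemma within_lin (a b : R) (u v w : R -> R) (A : set R) :
  {within A, continuous u} -> {within A, continuous v} ->
  (forall t, w t = a * u t + b * v t) -> {within A, continuous w}.
Proof.
move=> cu cv /funext -> x; apply: cvgD; apply: cvgM; try exact: cvg_cst.
  exact: cu.
exact: cv.
Qed.

Lemma seg_continuousD l g1 g2 : seg_continuous l g1 -> seg_continuous l g2 ->
  seg_continuous l (fun t => g1 t + g2 t).
Proof.
move=> [R1 I1] [R2 I2]; split.
  by apply: (within_lin (a := 1) (b := 1) R1 R2) => t; rewrite cReD !mul1r.
by apply: (within_lin (a := 1) (b := 1) I1 I2) => t; rewrite cImD !mul1r.
Qed.

Lemma seg_continuousZ l g a : seg_continuous l g ->
  seg_continuous l (fun t => a * g t).
Proof.
move=> [Rg Ig]; split.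
  apply: (within_lin (a := Re a) (b := - Im a) Rg Ig) => t.
  by rewrite cReM mulNr.
apply: (within_lin (a := Re a) (b := Im a) Ig Rg) => t.
by rewrite cImM.
Qed.

Lemma cintD l g1 g2 : seg_continuous l g1 -> seg_continuous l g2 ->
  cint l (fun t => g1 t + g2 t) = cint l g1 + cint l g2.
Proof.
move=> [/seg_integrable R1 /seg_integrable I1].
move=> [/seg_integrable R2 /seg_integrable I2].
apply: cplx_ext; rewrite ?cReD ?cImD /= -RintegralD//; apply: eq_Rintegral => t _.
  by rewrite cReD.
by rewrite cImD.
Qed.

Lemma Rintegral_lin (u v : R -> R) l (a b : R) :
  {within `[0, l], continuous u} -> {within `[0, l], continuous v} ->
  \int[mu]_(t in `[0, l]) (a * u t + b * v t) =
  a * \int[mu]_(t in `[0, l]) u t + b * \int[mu]_(t in `[0, l]) v t.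
Proof.
move=> cu cv; have z0 : {within `[0, l], continuous (cst 0 : R -> R)}.
  by move=> x; exact: cvg_cst.
have H w (c : R) : {within `[0, l], continuous w} ->
    {within `[0, l], continuous (fun t => c * w t)}.
  move=> cw; apply: (within_lin (a := c) (b := 0) cw z0) => t /=.
  by rewrite mul0r addr0.
by rewrite RintegralD ?RintegralZl//; apply: seg_integrable => //; exact: H.
Qed.

Lemma cintZ l g a : seg_continuous l g ->
  cint l (fun t => a * g t) = a * cint l g.
Proof.
move=> [Rg Ig]; apply: cplx_ext; rewrite ?cReM ?cImM /=.
  rewrite -mulNr -Rintegral_lin//; apply: eq_Rintegral => t _.
  by rewrite cReM mulNr.
by rewrite -Rintegral_lin//; apply: eq_Rintegral => t _; rewrite cImM.
Qed.

Lemma eq_cint l g1 g2 : (forall t, 0 <= t <= l -> g1 t = g2 t) ->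
  cint l g1 = cint l g2.
Proof.
move=> H; apply: cplx_ext; apply: eq_Rintegral => t /set_mem /=;
  by rewrite in_itv/= => /H ->.
Qed.

Lemma cint_split h k g : 0 <= h -> 0 <= k -> seg_continuous (h + k) g ->
  cint (h + k) g = cint h g + cint k (fun t => g (h + t)).
Proof.
by move=> h0 k0 [Rg Ig]; apply: cplx_ext; rewrite ?cReD ?cImD /= Rintegral_segmentD.
Qed.

Lemma Rintegral_seg_cst l (c : R) : 0 <= l ->
  \int[mu]_(t in `[0, l]) c = c * l.
Proof.
move=> l0; rewrite Rintegral_cst//= lebesgue_measure_itv /= lte_fin.
move: l0; rewrite le_eqVlt => /predU1P[<-|l0]; first by rewrite ltxx.
by rewrite l0 -EFinB subr0.
Qed.

Lemma norm_Rintegral_seg l (u : R -> R) K : 0 <= l ->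
  {within `[0, l], continuous u} ->
  (forall t, 0 <= t <= l -> `|u t| <= K) ->
  `|\int[mu]_(t in `[0, l]) u t| <= K * l.
Proof.
move=> l0 cu uK.
have cK (c : R) : {within `[0, l], continuous (cst c : R -> R)}.
  by move=> x; exact: cvg_cst.
rewrite ler_norml -mulNr -!Rintegral_seg_cst//; apply/andP; split.
  apply: le_Rintegral; [by []|exact: (seg_integrable (cK _))|exact: seg_integrable|].
  by move=> t /=; rewrite in_itv/= => /uK; rewrite ler_norml => /andP[].
apply: le_Rintegral; [by []|exact: seg_integrable|exact: (seg_integrable (cK _))|].
by move=> t /=; rewrite in_itv/= => /uK; rewrite ler_norml => /andP[].
Qed.

(** The factor 2 arises because the real and imaginary parts are bounded separately. *)
Lemma cmod_cint l g K : 0 <= l -> seg_continuous l g ->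
  (forall t, 0 <= t <= l -> cmod (g t) <= K) ->
  cmod (cint l g) <= 2 * K * l.
Proof.
move=> l0 [Rg Ig] gK.
have /= := cmod_le_ReIm (cint l g).
have := norm_Rintegral_seg l0 Rg
  (fun t H => le_trans (le_Re_cmod (g t)) (gK t H)).
have := norm_Rintegral_seg l0 Ig
  (fun t H => le_trans (le_Im_cmod (g t)) (gK t H)).
by lra.
Qed.

End SegmentIntegral.

(** * Complex derivatives *)

Section ComplexDerivative.
Variable R : realType.
Local Notation C := (Cplx R).
Implicit Types (f g : C -> C) (a x y z c : C).

(** Complex differentiability with real tolerances and without division, so that [y = x] is no
    exception. *)
Definition cdiff f x := exists a, forall e : R, 0 < e -> exists2 d : R, 0 < d &
  forall y, cmod (y - x) < d -> cmod (f y - f x - a * (y - x)) <= e * cmod (y - x).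

Lemma derivable_cdiff f x : derivable f x 1 -> cdiff f x.
Proof.
move=> /cvg_ex[a /cvgrPdist_lt H]; exists a => e e0.
have /H : (0 : C) < e%:rc by rewrite ltcR.
rewrite near_withinE => /nbhs_cmodP[d d0 {}H]; exists d => // y yx.
have [->|yNx] := eqVneq y x; first by rewrite !subrr mulr0 subr0 cmod0 mulr0.
have {}yNx : y - x != 0 by rewrite subr_eq0.
have := H (y - x); rewrite subr0 => /(_ yx yNx).
rewrite norm_cmod ltcR /shift /= => /ltW.
rewrite -(ler_pM2r (x := cmod (y - x))) ?cmod_gt0// -cmodM.
congr (_ <= _); rewrite -cmodN; congr cmod.
rewrite /GRing.scale /= mulr1 subrK; field.
by [].
Qed.

Lemma cdiff_continuous f x : cdiff f x -> {for x, continuous f}.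
Proof.
move=> [a /(_ 1 ltr01)[d d0 H]] A /nbhs_cmodP[e e0 fA]; apply/nbhs_cmodP.
have a0 : 0 < cmod a + 1 by rewrite ltr_wpDl// cmod_ge0.
exists (Num.min d (e / (cmod a + 1))); first by rewrite lt_min d0 divr_gt0.
move=> y; rewrite lt_min => /andP[/H yd]; rewrite ltr_pdivlMr// => ye.
apply: fA; have -> : f y - f x = (f y - f x - a * (y - x)) + a * (y - x) by ring.
apply: le_lt_trans (cmodD _ _) _; rewrite cmodM.
by apply: le_lt_trans ye; lra.
Qed.

Lemma derivable_mul f (g : C -> C) x : derivable f x 1 -> derivable g x 1 ->
  derivable (fun y => f y * g y) x 1.
Proof. by move=> df dg; exact: (derivableM df dg). Qed.

Lemma derivable_sub f (g : C -> C) x : derivable f x 1 -> derivable g x 1 ->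
  derivable (fun y => f y - g y) x 1.
Proof. by move=> df dg; exact: (derivableB df dg). Qed.

Lemma derivable_add f (g : C -> C) x : derivable f x 1 -> derivable g x 1 ->
  derivable (fun y => f y + g y) x 1.
Proof. by move=> df dg; exact: (derivableD df dg). Qed.

Lemma derivable_const c x : derivable (fun _ : C => c) x 1.
Proof. exact: derivable_cst. Qed.

Arguments derivable_mul {f g x} df dg _ _ : rename.
Arguments derivable_sub {f g x} df dg _ _ : rename.
Arguments derivable_add {f g x} df dg _ _ : rename.
Arguments derivable_const c x _ _ : clear implicits.

Lemma derivable_quotient f (g : C -> C) x : derivable f x 1 -> derivable g x 1 ->
  g x != 0 -> derivable (fun y => f y / g y) x 1.
Proof.
move=> df dg g0; have dV : derivable (fun y => (g y)^-1) x 1 by exact: derivableV.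
exact: (derivable_mul df dV).
Qed.

Lemma derivable_shift c x : derivable (fun y : C => y - c) x 1.
Proof.
have did : derivable (fun y : C => y) x 1 by exact: derivable_id.
exact: (derivable_sub did (derivable_const c x)).
Qed.

Lemma derivable_pow f n x : derivable f x 1 -> derivable (fun y => f y ^+ n) x 1.
Proof.
move=> df; elim: n => [|n IH].
  by under eq_fun do rewrite expr0; exact: derivable_const.
by under eq_fun do rewrite exprS; exact: (derivable_mul df IH).
Qed.

Lemma derivable_poly (p : {poly C}) x : derivable (fun y => p.[y]) x 1.
Proof.
elim/poly_ind: p => [|p c IH].
  by under eq_fun do rewrite horner0; exact: derivable_const.
under eq_fun do rewrite hornerMXaddC.
have did : derivable (fun y : C => y) x 1 by exact: derivable_id.
exact: (derivable_add (derivable_mul IH did) (derivable_const c x)).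
Qed.

Lemma holomorphic_near_derivable (A : set C) f z :
  holomorphic_near A f -> A z -> derivable f z 1.
Proof. by move=> [U [_ AU Uf]] /AU /Uf. Qed.

End ComplexDerivative.

(* [derivable] unfolds to a product, whose binders would otherwise become
   implicit arguments of these lemmas. *)
Arguments derivable_mul {R f g x} df dg _ _ : rename.
Arguments derivable_sub {R f g x} df dg _ _ : rename.
Arguments derivable_add {R f g x} df dg _ _ : rename.
Arguments derivable_const {R} c x _ _.
Arguments derivable_shift {R} c x _ _.
Arguments derivable_poly {R} p x _ _.
Arguments holomorphic_near_derivable {R A f z} hf Az _ _ : rename.

(** * Goursat's theorem for squares *)

Section Goursat.
Variable R : realType.
Local Notation C := (Cplx R).
Local Notation i := ('i%C : C).
Implicit Types (f : C -> C) (z v a x y p : C) (l h k t : R).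

(** Here [z] is the lower left corner; the alternatives are the bottom, top, right and left
    sides. *)
Definition edge z l y := exists2 t, 0 <= t <= l &
  [\/ y = z + t%:rc, y = z + l%:rc * i + t%:rc,
      y = z + l%:rc + t%:rc * i | y = z + t%:rc * i].

Definition square z l y := Re z <= Re y <= Re z + l /\ Im z <= Im y <= Im z + l.

Lemma edge_square z l y : edge z l y -> square z l y.
Proof.
move=> [t t01 [] ->]; rewrite /square; case: z => u v /=; split; lra.
Qed.

(** The signs encode the counterclockwise orientation; the factor [i] is the velocity along the
    vertical sides. *)
Definition edge_sum f z l t : C :=
  f (z + t%:rc) - f (z + l%:rc * i + t%:rc)
  + i * (f (z + l%:rc + t%:rc * i) - f (z + t%:rc * i)).

(* The contour integral of [f] along the boundary of [square z l]: the four
   sides are traversed simultaneously, so that a single integrand results. *)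
Definition bint f z l : C := cint l (edge_sum f z l).

Definition pint f z v l : C := cint l (fun t => f (z + t%:rc * v)).

Lemma edge_line f z l : (forall y, edge z l y -> {for y, continuous f}) ->
  [/\ seg_continuous l (fun t => f (z + t%:rc)),
      seg_continuous l (fun t => f (z + l%:rc * i + t%:rc)),
      seg_continuous l (fun t => f (z + l%:rc + t%:rc * i)) &
      seg_continuous l (fun t => f (z + t%:rc * i))].
Proof.
move=> fc; split.
- under [X in seg_continuous _ X]eq_fun do rewrite -[_%:rc]mulr1.
  apply: seg_continuous_line => t t01; apply: fc; exists t => //.
  by rewrite mulr1; exact: Or41.
- under [X in seg_continuous _ X]eq_fun do rewrite -[X in _ + X]mulr1.
  apply: seg_continuous_line => t t01; apply: fc; exists t => //.
  by rewrite mulr1; exact: Or42.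
- apply: seg_continuous_line => t t01; apply: fc; exists t => //.
  exact: Or43.
- apply: seg_continuous_line => t t01; apply: fc; exists t => //.
  exact: Or44.
Qed.

Lemma edge_sum_continuous f z l :
  (forall y, edge z l y -> {for y, continuous f}) ->
  seg_continuous l (edge_sum f z l).
Proof.
move=> /edge_line[H1 H2 H3 H4]; rewrite /edge_sum.
under [X in seg_continuous _ X]eq_fun do
  rewrite mulrDr mulrN -[X in _ - X + _]mul1r -[X in _ + (_ - X)]mul1r -!mulNr.
by apply: seg_continuousD; apply: seg_continuousD => //;
  apply: seg_continuousZ => //; apply: seg_continuousZ.
Qed.

Lemma bintE f z l : (forall y, edge z l y -> {for y, continuous f}) ->
  bint f z l = pint f z 1 l - pint f (z + l%:rc * i) 1 l
    + i * (pint f (z + l%:rc) i l - pint f z i l).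
Proof.
move=> /edge_line[H1 H2 H3 H4]; rewrite /bint /pint /edge_sum.
transitivity (cint l (fun t => (f (z + t%:rc) + (-1) * f (z + l%:rc * i + t%:rc))
  + i * (f (z + l%:rc + t%:rc * i) + (-1) * f (z + t%:rc * i)))).
  by apply: eq_cint => t _; rewrite !mulN1r.
have S2 := seg_continuousZ (-1) H2; have S4 := seg_continuousZ (-1) H4.
rewrite cintD; [|exact: seg_continuousD|exact/seg_continuousZ/seg_continuousD].
rewrite cintD// cintZ; last exact: seg_continuousD.
rewrite cintD// !cintZ// !mulN1r.
congr (_ - _ + _); by apply: eq_cint => t _; rewrite mulr1.
Qed.

Lemma pint_split f z z' v h k : 0 <= h -> 0 <= k ->
  (forall t, 0 <= t <= h + k -> {for z + t%:rc * v, continuous f}) ->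
  z' = z + h%:rc * v ->
  pint f z v (h + k) = pint f z v h + pint f z' v k.
Proof.
move=> h0 k0 fc ->; rewrite /pint cint_split//; last exact: seg_continuous_line.
congr (_ + _); apply: eq_cint => t _; congr f.
by rewrite rmorphD mulrDl addrA.
Qed.

(** Each inner side belongs to two quarters, which traverse it in opposite directions, so its
    contributions cancel. *)
Lemma bint_split f z h : 0 <= h ->
  (forall y, square z (h + h) y -> {for y, continuous f}) ->
  bint f z (h + h) = bint f z h + bint f (z + h%:rc) h
    + bint f (z + h%:rc * i) h + bint f (z + h%:rc + h%:rc * i) h.
Proof.
move=> h0 fc.
have zE : z = Complex (Re z) (Im z) by case: (z).
have sq y : edge z h y \/ edge (z + h%:rc) h y \/ edge (z + h%:rc * i) h y \/
    edge (z + h%:rc + h%:rc * i) h y -> {for y, continuous f}.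
  move=> H; apply: fc; move: H => [|[|[|]]] /edge_square;
    rewrite /square zE /=; lra.
rewrite !bintE; try (by move=> y ?; apply: sq; tauto);
  last by move=> y /edge_square; exact: fc.
have P z1 z2 v : (forall t, 0 <= t <= h + h -> square z (h + h) (z1 + t%:rc * v)) ->
    z2 = z1 + h%:rc * v ->
    pint f z1 v (h + h) = pint f z1 v h + pint f z2 v h.
  by move=> H; apply: pint_split => // t /H; exact: fc.
rewrite (P z (z + h%:rc)); [| |by rewrite mulr1]; last first.
  by move=> t t01; rewrite /square zE /=; lra.
rewrite (P _ (z + h%:rc * i + h%:rc * i + h%:rc) 1); last first.
- by rewrite mulr1 rmorphD mulrDl !addrA.
- by move=> t t01; rewrite /square zE /=; lra.
rewrite (P _ (z + h%:rc + h%:rc + h%:rc * i) i); last first.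
- by rewrite rmorphD !addrA.
- by move=> t t01; rewrite /square zE /=; lra.
rewrite (P z (z + h%:rc * i) i)//; last first.
  by move=> t t01; rewrite /square zE /=; lra.
rewrite rmorphD mulrDl !addrA.
(* The same grid points occur in different forms; once they are identified, [ring] can cancel the
   inner sides. *)
have -> : z + h%:rc + h%:rc * i + h%:rc * i = z + h%:rc * i + h%:rc * i + h%:rc.
  by ring.
have -> : z + h%:rc * i + h%:rc = z + h%:rc + h%:rc * i by ring.
have -> : z + h%:rc + h%:rc * i + h%:rc = z + h%:rc + h%:rc + h%:rc * i by ring.
by ring.
Qed.

Lemma cmod_edge_sum f z l K t : 0 <= t <= l ->
  (forall y, edge z l y -> cmod (f y) <= K) -> cmod (edge_sum f z l t) <= 4 * K.
Proof.
move=> t01 fK; rewrite /edge_sum.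
apply: le_trans (cmodD _ _) _; rewrite cmodM cmod_i mul1r.
have K1 : cmod (f (z + t%:rc)) <= K.
  by apply: fK; exists t => //; exact: Or41.
have K2 : cmod (f (z + l%:rc * i + t%:rc)) <= K.
  by apply: fK; exists t => //; exact: Or42.
have K3 : cmod (f (z + l%:rc + t%:rc * i)) <= K.
  by apply: fK; exists t => //; exact: Or43.
have K4 : cmod (f (z + t%:rc * i)) <= K.
  by apply: fK; exists t => //; exact: Or44.
have := cmodB (f (z + t%:rc)) (f (z + l%:rc * i + t%:rc)).
have := cmodB (f (z + l%:rc + t%:rc * i)) (f (z + t%:rc * i)).
by lra.
Qed.

(* The four terms of [edge_sum] cancel on affine functions. *)
Lemma cmod_bint_affine f z l K a p c : 0 <= l ->
  (forall y, edge z l y -> {for y, continuous f}) ->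
  (forall y, edge z l y -> cmod (f y - c - a * (y - p)) <= K) ->
  cmod (bint f z l) <= 8 * K * l.
Proof.
move=> l0 fc fK.
have -> : 8 * K * l = 2 * (4 * K) * l by ring.
apply: cmod_cint => //; first exact: edge_sum_continuous.
move=> t t01.
have := cmod_edge_sum t01 fK; congr (cmod _ <= _); rewrite /edge_sum.
have ii : i * i = -1 by rewrite -expr2 sqr_i.
ring: ii.
Qed.

(** The supremum of the left endpoints works: every left endpoint lies below every right endpoint,
    as the comparison at the larger of the two indices shows. *)
Lemma nested_segments (u l : nat -> R) :
  (forall n, u n <= u n.+1) -> (forall n, u n.+1 + l n.+1 <= u n + l n) ->
  (forall n, 0 <= l n) ->
  exists s : R, forall n, u n <= s <= u n + l n.
Proof.
move=> u_le ul_ge l0.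
have uh : {homo u : m n / (m <= n)%N >-> m <= n}.
  by apply: homo_leq => //; exact: le_trans.
have ulh : {homo (fun n => u n + l n) : m n / (m <= n)%N >-> n <= m}.
  apply: homo_leq => [x//|y x z yx zy|n]; [exact: le_trans zy yx|exact: ul_ge].
have H m n : u m <= u n + l n.
  apply: le_trans (uh _ _ (leq_maxl m n)) _.
  apply: le_trans (ulh _ _ (leq_maxr m n)); rewrite lerDl; exact: l0.
exists (sup (range u)) => n; apply/andP; split.
  apply: ub_le_sup; last by exists n.
  by exists (u 0%N + l 0%N) => _ [m _ <-].
by apply: ge_sup; [exists (u 0%N); exists 0%N|move=> _ [m _ <-]].
Qed.

(** Pigeonhole: four quarters below [k * h ^+ 2] could not add up to [4 * (k * h ^+ 2)]. The three
    negations match the failed tests in the selection of a quarter in [goursat]. *)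
Lemma bint_quarter f z h k : 0 <= h ->
  (forall y, square z (h + h) y -> {for y, continuous f}) ->
  k * (h + h) ^+ 2 <= cmod (bint f z (h + h)) ->
  ~ k * h ^+ 2 <= cmod (bint f z h) ->
  ~ k * h ^+ 2 <= cmod (bint f (z + h%:rc) h) ->
  ~ k * h ^+ 2 <= cmod (bint f (z + h%:rc * i) h) ->
  k * h ^+ 2 <= cmod (bint f (z + h%:rc + h%:rc * i) h).
Proof.
move=> h0 fc; rewrite bint_split//.
move: (bint f z h) (bint f (z + h%:rc) h) (bint f (z + h%:rc * i) h).
move: (bint f _ h) => b4 b1 b2 b3.
have -> : k * (h + h) ^+ 2 = 4 * (k * h ^+ 2) by ring.
move: (k * h ^+ 2) => K H /negP + /negP + /negP; rewrite -!ltNge.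
have := cmodD (b1 + b2 + b3) b4; have := cmodD (b1 + b2) b3; have := cmodD b1 b2.
by lra.
Qed.

(** Bisection: a nonzero integral yields nested squares whose integrals stay at least [c] times
    their area, whereas differentiability at the common point forces a smaller multiple of the
    area. *)
Lemma goursat f z l : 0 < l -> (forall y, square z l y -> cdiff f y) ->
  bint f z l = 0.
Proof.
move=> l0 fd; apply/eqP; rewrite -cmod_eq0; apply/eqP/le_anti.
rewrite cmod_ge0 andbT leNgt; apply/negP => b0.
set c := cmod (bint f z l) / l ^+ 2.
have l20 : 0 < l ^+ 2 by rewrite exprn_gt0.
have c0 : 0 < c by rewrite divr_gt0.
pose big z' h := c * h ^+ 2 <= cmod (bint f z' h).
(* The last quarter is taken untested; [bint_quarter] shows that it is big when the other three are
   not. *)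
pose next h z' :=
  if `[< big z' h >] then z'
  else if `[< big (z' + h%:rc) h >] then z' + h%:rc
  else if `[< big (z' + h%:rc * i) h >] then z' + h%:rc * i
  else z' + h%:rc + h%:rc * i.
pose ls n := l / 2 ^+ n.
have ls0 n : 0 < ls n by rewrite divr_gt0// exprn_gt0.
have lsS n : ls n = ls n.+1 + ls n.+1.
  by rewrite /ls exprS; field; rewrite expf_neq0.
pose zs := fix zs n := if n is m.+1 then next (ls n) (zs m) else z.
have nextP n : [/\ Re (zs n) <= Re (zs n.+1), Re (zs n.+1) <= Re (zs n) + ls n.+1,
    Im (zs n) <= Im (zs n.+1) & Im (zs n.+1) <= Im (zs n) + ls n.+1].
  have := ls0 n.+1; rewrite [zs n.+1]/= -/zs /next.
  case: (zs n) => u v h0.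
  by case: ifP => _ /=; [|case: ifP => _ /=; [|case: ifP => _ /=]]; split; lra.
have [p1 Hp1] : exists s : R, forall n, Re (zs n) <= s <= Re (zs n) + ls n.
  apply: nested_segments => n; try by case: (nextP n).
    by rewrite (lsS n); case: (nextP n); lra.
  exact/ltW/ls0.
have [p2 Hp2] : exists s : R, forall n, Im (zs n) <= s <= Im (zs n) + ls n.
  apply: nested_segments => n; try by case: (nextP n).
    by rewrite (lsS n); case: (nextP n); lra.
  exact/ltW/ls0.
have sub n : Re z <= Re (zs n) /\ Re (zs n) + ls n <= Re z + l /\
    Im z <= Im (zs n) /\ Im (zs n) + ls n <= Im z + l.
  elim: n => [|n IH]; first by rewrite /ls expr0 divr1.
  by have [] := nextP n; have := lsS n; lra.
have subsq n y : square (zs n) (ls n) y -> square z l y.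
  by rewrite /square; have := sub n; lra.
have fc n y : square (zs n) (ls n) y -> {for y, continuous f}.
  by move=> /subsq /fd /cdiff_continuous.
have Hbig n : big (zs n) (ls n).
  elim: n => [|n IH].
    by rewrite /big /ls expr0 divr1 /zs /c divfK// gt_eqF.
  rewrite [zs n.+1]/= -/zs /next; set h := ls n.+1 in IH *.
  have h0 : 0 < h by exact: ls0.
  case: asboolP => [B1|N1]; first exact: B1.
  case: asboolP => [B2|N2]; first exact: B2.
  case: asboolP => [B3|N3]; first exact: B3.
  apply: bint_quarter N1 N2 N3; first exact: ltW.
    by rewrite /h -lsS; exact: fc.
  by rewrite /h -lsS.
have [a Ha] : cdiff f (Complex p1 p2).
  by apply/fd/(subsq 0%N); split; [exact: (Hp1 0%N)|exact: (Hp2 0%N)].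
(* Points of the edge are within [2 * ls n] of the common point, so [cmod_bint_affine] yields
   [8 * 2 / 17 = 16 / 17] of [c * ls n ^+ 2], strictly below the lower bound [Hbig]. *)
have [d d0 Hd] := Ha (c / 17) (divr_gt0 c0 (ltr0Sn _ _)).
have [n Hn] : exists n, 2 * ls n < d.
  exists (Num.bound (2 * l / d)).
  have := @upper_nthrootP _ (2 * l / d) _ (leqnn _).
  by rewrite ltr_pdivrMr// /ls mulrA ltr_pdivrMr ?exprn_gt0// [d * _]mulrC.
have := Hbig n; apply/negP; rewrite -ltNge.
have K y : edge (zs n) (ls n) y ->
    cmod (f y - f (Complex p1 p2) - a * (y - Complex p1 p2)) <= c / 17 * (2 * ls n).
  move=> /edge_square[yR yI].
  have yp : cmod (y - Complex p1 p2) <= 2 * ls n.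
    apply: le_trans (cmod_le_ReIm _) _; rewrite cReD cImD cReN cImN /=.
    have : `|Re y - p1| <= ls n by rewrite ler_norml; have := Hp1 n; lra.
    have : `|Im y - p2| <= ls n by rewrite ler_norml; have := Hp2 n; lra.
    by lra.
  apply: le_trans (Hd _ (le_lt_trans yp Hn)) _.
  by rewrite ler_wpM2l// divr_ge0 ?ltW.
apply: le_lt_trans (cmod_bint_affine (ltW (ls0 n)) _ K) _.
  by move=> y /edge_square; exact: fc.
have : 0 < c * ls n ^+ 2 by rewrite mulr_gt0// exprn_gt0.
rewrite (_ : 8 * (c / 17 * (2 * ls n)) * ls n = 16 / 17 * (c * ls n ^+ 2)); first lra.
by ring.
Qed.

End Goursat.

(** * The maximum modulus principle *)

Section MaximumModulus.
Variable R : realType.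
Local Notation C := (Cplx R).
Local Notation i := ('i%C : C).
Implicit Types (f : C -> C) (z v a x y p c : C) (l h k t r : R).

(* The square removes the singularity of [(f y - f x) / (y - x)] at [x]: the
   quotient, which is 0 at [x] since division by 0 yields 0, has derivative
   [f' x ^+ 2] there. *)
Lemma cdiff_sqr_quotient f x : cdiff f x ->
  cdiff (fun y => (f y - f x) ^+ 2 / (y - x)) x.
Proof.
move=> [a fa]; exists (a ^+ 2) => e e0.
have A0 : 0 < 2 * cmod a + 1 by rewrite ltr_wpDl// mulr_ge0// cmod_ge0.
(* The bound 1 controls [D / u] below, and the other bound absorbs the factor [2 * cmod a + 1]. *)
pose e' := Num.min 1 (e / (2 * cmod a + 1)).
have e'0 : 0 < e' by rewrite lt_min ltr01 divr_gt0.
have [d d0 fd] := fa e' e'0; exists d => // y yd.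
have [->|] := eqVneq y x; first by rewrite !subrr mulr0 subr0 cmod0 mulr0.
have {fd} := fd y yd; rewrite (subrr x) invr0 mulr0 subr0 -subr_eq0.
set u := y - x; set w := f y - f x => HD u0.
set D := w - a * u in HD.
(* Difference of squares, with [w + a * u = D + 2 * a * u]. *)
have -> : w ^+ 2 / u - a ^+ 2 * u = D * (D / u + 2 * a).
  rewrite /D; field.
  by [].
rewrite cmodM.
have u_gt0 : 0 < cmod u by rewrite cmod_gt0.
have Du : cmod (D / u + 2 * a) <= 2 * cmod a + 1.
  apply: le_trans (cmodD _ _) _; rewrite !cmodM cmodV addrC.
  have -> : cmod (2 : C) = 2 by rewrite -(rmorph_nat (real_complex R)) cmod_rc ger0_norm.
  rewrite lerD2l ler_pdivrMr// mul1r; apply: le_trans HD _.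
  by rewrite ler_piMl ?cmod_ge0// /e' ge_min lexx.
have : e' * (2 * cmod a + 1) <= e by rewrite -ler_pdivlMr// /e' ge_min lexx orbT.
move=> He; apply: le_trans (ler_pM (cmod_ge0 _) (cmod_ge0 _) HD Du) _.
by rewrite mulrAC ler_wpM2r// ltW.
Qed.

(** By Goursat, [(f y - f z) ^+ 2 / (y - z)] integrates to 0 over the square centred at [z] with
    side [2 * r], whose edge lies in the annulus. Separating the term [f z ^+ 2 / (y - z)] leaves an
    integrand controlled by [B], hence a quadratic inequality for [cmod (f z)]. *)
Lemma cauchy_estimate f z r (B : R) : 0 < r ->
  (forall y, cmod (y - z) <= 2 * r -> derivable f y 1) ->
  (forall y, r <= cmod (y - z) <= 2 * r -> cmod (f y) <= B) ->
  cmod (f z) <= 9 * B.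
Proof.
move=> r0 fd fB.
pose q := z - r%:rc - r%:rc * i; pose l := 2 * r.
have l0 : 0 < l by rewrite mulr_gt0.
have zE : z = Complex (Re z) (Im z) by case: (z).
have sq y : square q l y -> cmod (y - z) <= 2 * r.
  rewrite /square /q /l zE /= => -[yR yI].
  apply: le_trans (cmod_le_ReIm _) _; rewrite cReD cImD cReN cImN /=.
  have : `|Re y - Re z| <= r by rewrite ler_norml; lra.
  have : `|Im y - Im z| <= r by rewrite ler_norml; lra.
  by lra.
have edge_far y : edge q l y -> r <= cmod (y - z).
  rewrite /q /l zE => -[t _ []] ->;
    [apply: le_trans (le_Im_cmod _)|apply: le_trans (le_Im_cmod _)
    |apply: le_trans (le_Re_cmod _)|apply: le_trans (le_Re_cmod _)] => /=;
    rewrite ler_normr; apply/orP; (left; lra) || (right; lra).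
have edge_neq y : edge q l y -> y - z != 0.
  by move=> /edge_far rz; rewrite -cmod_gt0 (lt_le_trans r0).
pose g y := (f y - f z) ^+ 2 / (y - z).
have gd y : square q l y -> cdiff g y.
  move=> /sq /fd fy; have [->|yz] := eqVneq y z.
    by apply/cdiff_sqr_quotient/derivable_cdiff/fd; rewrite subrr cmod0 ltW.
  apply: derivable_cdiff; apply: derivable_quotient; last by rewrite subr_eq0.
    have fc := derivable_sub fy (derivable_const (f z) y).
    exact: (derivable_mul fc fc).
  exact: derivable_shift.
have g0 := goursat l0 gd.
have gc y : edge q l y -> {for y, continuous g}.
  by move=> /edge_square/gd; exact: cdiff_continuous.
pose k y := (y - z)^-1 : C.
have kc y : edge q l y -> {for y, continuous k}.
  move=> /edge_neq yz; apply/cdiff_continuous/derivable_cdiff.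
  by apply: derivableV => //; exact: derivable_shift.
(* Opposite sides are at conjugate positions relative to [z], up to sign, so the four reciprocals
   combine into one purely imaginary term. *)
have kE t : edge_sum k q l t =
    (4 * r / ((t - r) ^+ 2 + r ^+ 2))%:rc * i.
  have ii : i * i = -1 by rewrite -expr2 sqr_i.
  have n0 : (t - r) ^+ 2 + r ^+ 2 != 0.
    by rewrite gt_eqF// ltr_wpDl ?sqr_ge0// exprn_gt0.
  apply: cplx_ext; rewrite /edge_sum /k /q /l zE /=.
    field.
    lra.
  field.
  lra.
(* The exact value is [2 * pi * i]. Since [(t - r) ^+ 2 <= r ^+ 2], the imaginary part of the
   integrand is at least [2 / r] over a length of [2 * r], which gives 4. *)
have K4 : 4 <= cmod (bint k q l).
  apply: le_trans (le_Im_cmod _); apply: le_trans (ler_norm _) => /=.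
  have -> : 4 = 2 / r * l by rewrite /l; field; rewrite gt_eqF.
  have [_ kI] := edge_sum_continuous kc.
  have c0 : {within `[0, l], continuous (cst (2 / r) : R -> R)}.
    by move=> x; exact: cvg_cst.
  rewrite -Rintegral_seg_cst; last exact: ltW.
  apply: le_Rintegral; [by []|exact: (seg_integrable c0)|exact: seg_integrable|].
  move=> t /=; rewrite in_itv /= => /andP[t0 tl]; rewrite kE /=.
  rewrite mulr1 mul0r addr0 ler_pdivrMr// mulrAC ler_pdivlMr.
    have : 0 <= t * (2 * r - t) by rewrite mulr_ge0// subr_ge0.
    by nra.
  by rewrite ltr_wpDl ?sqr_ge0// exprn_gt0.
have B0 : 0 <= B.
  apply: le_trans (cmod_ge0 (f (z + r%:rc))) _; apply: fB.
  rewrite addrC addKr cmod_rc gtr0_norm//; lra.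
have M0 := cmod_ge0 (f z); set M := cmod (f z) in M0 *.
(* Removing [f z ^+ 2 / (y - z)] from [g] leaves a numerator divisible by [f y], hence of order [B]
   on the edge. *)
pose u y := g y + - (f z ^+ 2) * k y : C.
have uB y : edge q l y -> cmod (u y) <= (B ^+ 2 + 2 * M * B) / r.
  move=> ey; have yr := edge_far y ey.
  have {}fB : cmod (f y) <= B.
    by apply: fB; rewrite yr sq//; exact: edge_square.
  have -> : u y = (f y * (f y - 2 * f z)) / (y - z).
    by rewrite /u /g /k; ring.
  rewrite !cmodM cmodV; apply: ler_pM => //.
  - by rewrite mulr_ge0// cmod_ge0.
  - by rewrite invr_ge0 cmod_ge0.
  - have -> : B ^+ 2 + 2 * M * B = B * (B + 2 * M) by ring.
    apply: ler_pM => //; rewrite ?cmod_ge0//.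
    apply: le_trans (cmodB _ _) _; rewrite cmodM lerD//.
    by rewrite -(rmorph_nat (real_complex R)) cmod_rc ger0_norm.
  - by rewrite lef_pV2// posrE// (lt_le_trans r0).
have uE : cint l (edge_sum u q l) = - (f z ^+ 2) * bint k q l.
  transitivity (cint l (fun t => edge_sum g q l t + - (f z ^+ 2) * edge_sum k q l t)).
    by apply: eq_cint => t _; rewrite /edge_sum /u; ring.
  have kS := edge_sum_continuous kc; have gS := edge_sum_continuous gc.
  rewrite cintD//; last exact: seg_continuousZ.
  by rewrite cintZ// -/(bint g q l) g0 add0r.
have uc y : edge q l y -> {for y, continuous u}.
  move=> ey; have ck : {for y, continuous (fun y => - (f z ^+ 2) * k y : C)}.
    exact: (@continuousM _ _ _ _ _ (@cst_continuous _ _ _ _) (kc y ey)).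
  exact: (continuousD (gc y ey) ck).
have := cmod_cint (ltW l0) (edge_sum_continuous uc)
  (fun t H => cmod_edge_sum H uB).
rewrite uE cmodM cmodN cmodX -/M.
have -> : 2 * (4 * ((B ^+ 2 + 2 * M * B) / r)) * l = 16 * (B ^+ 2 + 2 * M * B).
  by rewrite /l; field; rewrite gt_eqF.
have : M ^+ 2 * 4 <= M ^+ 2 * cmod (bint k q l) by rewrite ler_wpM2l// sqr_ge0.
(* The inequality amounts to [M * (M - 8 * B) <= 4 * B ^+ 2], which excludes [M > 9 * B]. *)
move=> H1 /(le_trans H1) {}H1; rewrite leNgt; apply/negP => MB.
nra.
Qed.

Lemma pow_lt_eps (q e : R) : 0 <= q < 1 -> 0 < e -> exists n, q ^+ n < e.
Proof.
move=> /andP[q0 q1] e0; have /cvg_expr : `|q| < 1 by rewrite ger0_norm.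
move=> /cvgrPdist_lt/(_ e e0)[n _ /(_ n (leqnn n))] /=.
by rewrite sub0r normrN ger0_norm ?exprn_ge0// => ?; exists n.
Qed.

(** The Cauchy estimate is applied to the power [2 * n] of [f], with [n] so large that [q ^+ n]
    beats the constant 9; then [M <= cmod (f z) ^+ 2] would give [M ^+ n < M ^+ n]. *)
Lemma annulus_estimate f z r (q M : R) : 0 < r -> 0 <= q < 1 -> 0 < M ->
  (forall y, cmod (y - z) <= 2 * r -> derivable f y 1) ->
  (forall y, r <= cmod (y - z) <= 2 * r -> cmod (f y) ^+ 2 <= q * M) ->
  cmod (f z) ^+ 2 < M.
Proof.
move=> r0 q01 M0 fd fM; rewrite ltNge; apply/negP => Mf.
have [q0 _] := andP q01.
have [n qn] := pow_lt_eps q01 (e := 9^-1) ltac:(by rewrite invr_gt0).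
have gd y : cmod (y - z) <= 2 * r -> derivable (fun y => f y ^+ 2 ^+ n) y 1.
  by move=> /fd /derivable_pow fy; exact/derivable_pow/fy.
have gM y : r <= cmod (y - z) <= 2 * r -> cmod (f y ^+ 2 ^+ n) <= (q * M) ^+ n.
  move=> /fM yM; rewrite !cmodX lerXn2r ?nnegrE ?sqr_ge0//.
  by rewrite mulr_ge0// ltW.
have := cauchy_estimate r0 gd gM; rewrite !cmodX leNgt => /negP; apply.
apply: lt_le_trans (lerXn2r n _ _ Mf); rewrite ?nnegrE ?sqr_ge0// ?(ltW M0)//.
rewrite exprMn mulrA gtr_pMl ?exprn_gt0//.
by rewrite mulrC -ltr_pdivlMr// div1r.
Qed.

(** The perturbing factor equals [(1 + k * conjc z * y) / N]. For [k >= 0] this is Lagrange's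
    identity for the vectors [(1, sqrt k * z)] and [(1, sqrt k * y)]. *)
Lemma perturbation_sqr z y k : let N := 1 + k * cmod z ^+ 2 in N != 0 ->
  cmod (1 + (k / N)%:rc * conjc z * (y - z)) ^+ 2 =
  (N * (1 + k * cmod y ^+ 2) - k * cmod (y - z) ^+ 2) / N ^+ 2.
Proof.
rewrite /= !cmod_sqr; case: z y => a b [u v] /= N0; field.
by [].
Qed.

(* Since [f z] is the value at [z] of
   [f y * (1 + k / N * z^* * (y - z))], the powers of this function violate
   the Cauchy estimate if [z] maximises [|f|^2 * (1 + k * |.|^2)]. *)
Lemma perturbation_bound f z y r k (L : R) : 0 < k -> 0 < r ->
  r <= cmod (y - z) -> cmod y <= L ->
  cmod (f y) ^+ 2 * (1 + k * cmod y ^+ 2) <=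
    cmod (f z) ^+ 2 * (1 + k * cmod z ^+ 2) ->
  let N := 1 + k * cmod z ^+ 2 in
  cmod (f y * (1 + (k / N)%:rc * conjc z * (y - z))) ^+ 2 <=
  (1 - k * r ^+ 2 / (N * (1 + k * L ^+ 2))) * cmod (f z) ^+ 2.
Proof.
move=> k0 r0 ry yL fy /=; set N := 1 + k * cmod z ^+ 2 in fy *.
set Y := 1 + k * cmod y ^+ 2 in fy.
have N0 : 0 < N by rewrite ltr_pwDl// mulr_ge0 ?sqr_ge0// ltW.
have Y0 : 0 < Y by rewrite ltr_pwDl// mulr_ge0 ?sqr_ge0// ltW.
have T0 : 0 < 1 + k * L ^+ 2 by rewrite ltr_pwDl// mulr_ge0 ?sqr_ge0// ltW.
have YT : Y <= 1 + k * L ^+ 2.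
  rewrite lerD2l ler_pM2l// lerXn2r ?nnegrE ?cmod_ge0//.
  exact: le_trans (cmod_ge0 _) yL.
set Q := cmod (y - z) ^+ 2.
have rQ : r ^+ 2 <= Q by rewrite lerXn2r ?nnegrE ?cmod_ge0// ltW.
have WE : cmod (1 + (k / N)%:rc * conjc z * (y - z)) ^+ 2 = (N * Y - k * Q) / N ^+ 2.
  by rewrite perturbation_sqr// gt_eqF.
have X0 : 0 <= (N * Y - k * Q) / N ^+ 2 by rewrite -WE sqr_ge0.
rewrite cmodM exprMn WE.
have fy' : cmod (f y) ^+ 2 <= cmod (f z) ^+ 2 * N / Y by rewrite ler_pdivlMr.
apply: le_trans (ler_wpM2r X0 fy') _.
have -> : cmod (f z) ^+ 2 * N / Y * ((N * Y - k * Q) / N ^+ 2) =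
   (1 - k * Q / (N * Y)) * cmod (f z) ^+ 2.
  by field; rewrite !gt_eqF.
(* The gain [k * Q / (N * Y)] becomes independent of [y] through [r ^+ 2 <= Q] and
   [Y <= 1 + k * L ^+ 2]. *)
rewrite ler_wpM2r ?sqr_ge0// lerD2l lerN2.
apply: ler_pM; [by rewrite mulr_ge0 ?sqr_ge0// ltW|by rewrite invr_ge0 mulr_ge0// ltW| |].
  by rewrite ler_pM2l.
by rewrite lef_pV2 ?posrE ?mulr_gt0// ler_pM2l.
Qed.

(** If the modulus exceeded [B] at some [z1] in [D], then for small [k] the weighted function
    [|f|^2 * (1 + k * |.|^2)] would attain its maximum over the closure at a point of [D]. There
    [perturbation_bound] provides a factor [q < 1] on an annulus, which contradicts
    [annulus_estimate]. *)
Lemma maximum_modulus (D : set C) f (B : R) : open D -> bounded_set D -> 0 <= B ->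
  {within closure D, continuous f} -> (forall z, D z -> derivable f z 1) ->
  (forall z, frontier D z -> cmod (f z) <= B) ->
  forall z, D z -> cmod (f z) <= B.
Proof.
move=> oD bD B0 cf df fB z1 Dz1; rewrite leNgt; apply/negP => Bf.
have cD : compact (closure D) by exact: compact_closure_bounded.
have D0 : closure D !=set0 by exists z1; exact: subset_closure.
have [zL _ HL] := compact_EVT_max D0 cD (continuous_subspaceT (@continuous_cmod R)).
set L := cmod zL in HL.
have BL : 0 <= B ^+ 2 * L ^+ 2 by rewrite mulr_ge0 ?sqr_ge0.
have AB : B ^+ 2 < cmod (f z1) ^+ 2.
  by rewrite ltrXn2r ?nnegrE ?cmod_ge0.
(* On the frontier the weight costs at most half of the gap [cmod (f z1) ^+ 2 - B ^+ 2]; the [+ 1]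
   keeps the denominator positive. *)
pose k := (cmod (f z1) ^+ 2 - B ^+ 2) / (2 * (B ^+ 2 * L ^+ 2 + 1)).
have k0 : 0 < k.
  by rewrite divr_gt0 ?subr_gt0// mulr_gt0// ltr_wpDl.
have kB : B ^+ 2 * (1 + k * L ^+ 2) < cmod (f z1) ^+ 2.
  have : k * (B ^+ 2 * L ^+ 2 + 1) * 2 = cmod (f z1) ^+ 2 - B ^+ 2.
    by rewrite /k; field; rewrite gt_eqF// ltr_wpDl// sqr_ge0.
  by nra.
pose phi z := cmod (f z) ^+ 2 * (1 + k * cmod z ^+ 2).
have cphi : {within closure D, continuous phi}.
  have H (u : C -> R) : {within closure D, continuous u} ->
      {within closure D, continuous (fun z => u z ^+ 2)}.
    by move=> cu x; apply: (@continuousM _ _ _ _ _ (cu x) (cu x)).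
  have cn : {within closure D, continuous (@cmod R)}.
    by apply: continuous_subspaceT; exact: continuous_cmod.
  have cfn : {within closure D, continuous (fun z => cmod (f z))}.
    by move=> x; apply: (continuous_comp (cf x)); exact: continuous_cmod.
  have ck : {within closure D, continuous (fun z => 1 + k * cmod z ^+ 2)}.
    move=> x; apply: cvgD; first exact: cvg_cst.
    by apply: cvgM; [exact: cvg_cst|exact: H cn x].
  by move=> x; apply: (@continuousM _ _ _ _ _ (H _ cfn x) (ck x)).
have [z0 /set_mem Dz0 Hz0] := compact_EVT_max D0 cD cphi.
have phi1 : cmod (f z1) ^+ 2 <= phi z0.
  apply: le_trans (Hz0 z1 _); last exact/mem_set/subset_closure.
  by rewrite /phi ler_peMr ?sqr_ge0// lerDl mulr_ge0 ?sqr_ge0// ltW.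
(* On the frontier [phi] is at most [B ^+ 2 * (1 + k * L ^+ 2)], which is less than [phi z0]. *)
have Dz0' : D z0.
  apply: contrapT => nD; have : frontier D z0.
    by split => // /interior_subset.
  move=> /fB f0; move: phi1; apply/negP; rewrite -ltNge; apply: le_lt_trans kB.
  rewrite /phi; apply: ler_pM; rewrite ?sqr_ge0//.
  - by rewrite addr_ge0// mulr_ge0 ?sqr_ge0// ltW.
  - by rewrite lerXn2r ?nnegrE ?cmod_ge0.
  rewrite lerD2l ler_pM2l// lerXn2r ?nnegrE ?cmod_ge0//.
  exact/HL/mem_set.
have f0 : 0 < cmod (f z0) ^+ 2.
  rewrite lt_neqAle sqr_ge0 andbT; apply/negP => /eqP E.
  move: phi1; rewrite /phi -E mul0r => ?; have := sqr_ge0 B; lra.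
have [d d0 Dd] : exists2 d : R, 0 < d & forall y, cmod (y - z0) < d -> D y.
  by apply/nbhs_cmodP; exact: open_nbhs_nbhs.
pose r := d / 3; have r0 : 0 < r by rewrite divr_gt0.
have Dr y : cmod (y - z0) <= 2 * r -> D y.
  by move=> yr; apply: Dd; apply: le_lt_trans yr _; rewrite /r; lra.
pose N := 1 + k * cmod z0 ^+ 2.
pose g y := f y * (1 + (k / N)%:rc * conjc z0 * (y - z0)).
pose q := 1 - k * r ^+ 2 / (N * (1 + k * L ^+ 2)).
have gd y : cmod (y - z0) <= 2 * r -> derivable g y 1.
  move=> /Dr /df fy.
  pose b := (k / N)%:rc * conjc z0 : C.
  have dw := derivable_mul (derivable_const b y) (derivable_shift z0 y).
  have dv := derivable_add (derivable_const 1 y) dw.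
  exact (derivable_mul fy dv).
have gq y : r <= cmod (y - z0) <= 2 * r -> cmod (g y) ^+ 2 <= q * cmod (f z0) ^+ 2.
  move=> /andP[ry /Dr Dy].
  have cDy : y \in closure D by exact/mem_set/subset_closure.
  by apply: perturbation_bound => //; [exact: HL|exact: Hz0].
have N0 : 0 < N by rewrite ltr_pwDl// mulr_ge0 ?sqr_ge0// ltW.
have T0 : 0 < 1 + k * L ^+ 2 by rewrite ltr_pwDl// mulr_ge0 ?sqr_ge0// ltW.
have q1 : q < 1.
  by rewrite /q ltrBlDr ltrDl divr_gt0// mulr_gt0// exprn_gt0.
have q0 : 0 <= q.
  rewrite -(pmulr_lge0 _ f0); apply: le_trans (sqr_ge0 _) (gq (z0 + r%:rc) _).
  rewrite addrC addKr cmod_rc gtr0_norm//; lra.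
(* As [g] and [f] agree at [z0], the estimate reads [cmod (f z0) ^+ 2 < cmod (f z0) ^+ 2]. *)
have := annulus_estimate r0 (introT andP (conj q0 q1)) f0 gd gq.
by rewrite /g subrr mulr0 addr0 mulr1 ltxx.
Qed.

End MaximumModulus.

(** * Node polynomials *)

Section Interpolation.
Variables (F : fieldType) (m : nat) (lambda : 'I_m -> F).
Implicit Types (w : 'I_m -> F) (j : 'I_m) (z : F).

(** For distinct nodes, the Lagrange basis polynomial at [lambda j] before its value there is
    normalised to 1. *)
Definition cofactor_poly j : {poly F} := \prod_(k < m | k != j) ('X - (lambda k)%:P).

(** The numerator of [\sum_j w j / (z - lambda j)] over the node polynomial as common
    denominator. *)
Definition numerator_poly w : {poly F} := \sum_(j < m) w j *: cofactor_poly j.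

Lemma node_cofactor j :
  \prod_(k < m) ('X - (lambda k)%:P) = ('X - (lambda j)%:P) * cofactor_poly j.
Proof. by rewrite (bigD1 j). Qed.

Lemma horner_numerator w z : (forall j, z != lambda j) ->
  (numerator_poly w).[z] =
  (\prod_(k < m) ('X - (lambda k)%:P)).[z] * \sum_(j < m) w j / (z - lambda j).
Proof.
move=> zl; rewrite horner_sum mulr_sumr; apply: eq_bigr => j _.
rewrite hornerZ (node_cofactor j) hornerM hornerXsubC; field.
by rewrite subr_eq0.
Qed.

Lemma cofactor_node0 j k : k != j -> (cofactor_poly j).[lambda k] = 0.
Proof.
move=> kj; rewrite horner_prod; apply/eqP/prodf_eq0; exists k => //.
by rewrite hornerXsubC subrr.
Qed.

(** The cofactors other than the [j]-th vanish at [lambda j]. This is how the residue [w j] enters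
    the final estimate. *)
Lemma horner_numerator_node w j :
  (numerator_poly w).[lambda j] = w j * (cofactor_poly j).[lambda j].
Proof.
rewrite horner_sum (bigD1 j)//= big1 ?addr0 ?hornerZ// => k kj.
by rewrite hornerZ cofactor_node0 ?mulr0// eq_sym.
Qed.

Lemma node_root j : (\prod_(k < m) ('X - (lambda k)%:P)).[lambda j] = 0.
Proof. by rewrite (node_cofactor j) hornerM hornerXsubC subrr mul0r. Qed.

Hypothesis lambda_inj : injective lambda.

Lemma cofactor_neq0 j : (cofactor_poly j).[lambda j] != 0.
Proof.
rewrite horner_prod; apply/prodf_neq0 => k kj.
by rewrite hornerXsubC subr_eq0 (inj_eq lambda_inj) eq_sym.
Qed.

Lemma size_cofactor j : (size (cofactor_poly j) <= m)%N.
Proof.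
have m0 : (0 < m)%N by exact: leq_ltn_trans (ltn_ord j).
rewrite size_prod => [|k _]; last by rewrite polyXsubC_eq0.
under eq_bigr do rewrite size_XsubC.
rewrite sum_nat_const cardC1 card_ord.
(* The [m - 1] factors of size 2 give the size [2 * (m - 1) + 1 - (m - 1) = m]. *)
by case: m m0 => // n _ /=; rewrite muln2 -addnn -addSn addnK.
Qed.

(** The difference of the two sides has size at most [m] and vanishes at the [m] distinct nodes. *)
Lemma lagrange_interpolation (q : {poly F}) : (size q <= m)%N ->
  q = \sum_(j < m) (q.[lambda j] / (cofactor_poly j).[lambda j]) *: cofactor_poly j.
Proof.
move=> qm; apply/eqP; rewrite -subr_eq0; apply/eqP.
apply: (@roots_geq_poly_eq0 _ _ (codom lambda)).
- apply/allP => _ /codomP[j ->]; rewrite rootE hornerD hornerN.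
  rewrite -/(numerator_poly _) horner_numerator_node divfK ?subrr//.
  exact: cofactor_neq0.
- by rewrite map_inj_uniq// enum_uniq.
- rewrite size_codom card_ord; apply: leq_trans (size_polyD _ _) _.
  rewrite size_polyN geq_max qm /=.
  apply: leq_trans (size_sum _ _ _) _; apply/bigmax_leqP => j _.
  exact: leq_trans (size_scale_leq _ _) (size_cofactor j).
Qed.

End Interpolation.

(** * Vector norms and values of the perturbed node polynomial *)

Section NodePolynomials.
Variable R : realType.
Local Notation C := (Cplx R).
Implicit Types (f : C -> C) (z x y : C).

Lemma enorm_ge0 n (v : 'cV[C]_n) : 0 <= enorm v.
Proof. exact: sqrtr_ge0. Qed.

Lemma cmod_le_enorm n (v : 'cV[C]_n) j : cmod (v j ord0) <= enorm v.
Proof.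
rewrite -(ger0_norm (cmod_ge0 (v j ord0))) -sqrtr_sqr ler_wsqrtr//.
by rewrite (bigD1 j)//= lerDl sumr_ge0// => k _; rewrite sqr_ge0.
Qed.

Lemma enorm_le_sum n (v : 'cV[C]_n) : enorm v <= \sum_(j < n) cmod (v j ord0).
Proof.
have S0 : 0 <= \sum_(j < n) cmod (v j ord0).
  by rewrite sumr_ge0// => j _; rewrite cmod_ge0.
rewrite -(ger0_norm S0) -sqrtr_sqr ler_wsqrtr//.
rewrite expr2 mulr_suml; apply: ler_sum => j _.
rewrite expr2 ler_wpM2l ?cmod_ge0// (bigD1 j)//= lerDl sumr_ge0// => k _.
exact: cmod_ge0.
Qed.

Lemma node_poly_monic m (lambda : 'I_m -> C) : node_poly lambda \is monic.
Proof. by apply: monic_prod => j _; exact: monicXsubC. Qed.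

Lemma size_node_poly m (lambda : 'I_m -> C) : size (node_poly lambda) = m.+1.
Proof. by rewrite size_prod_XsubC /index_enum -enumT size_enum_ord. Qed.

(** Both polynomials are monic of degree [m], so the leading terms cancel and the difference is
    determined by its values at the [m] nodes [lambda j] once these are distinct. *)
Lemma size_node_polyB m (lambda lambda' : 'I_m -> C) :
  (size (node_poly lambda - node_poly lambda')%R <= m)%N.
Proof.
apply/leq_sizeP => k; rewrite coefB leq_eqVlt => /predU1P[<-|mk].
  have lc (l : 'I_m -> C) : (node_poly l)`_m = 1 :> C.
    by have /monicP := node_poly_monic l; rewrite lead_coefE size_node_poly.
  by rewrite !lc subrr.
by rewrite !nth_default ?size_node_poly// subrr.
Qed.

Lemma cmod_node_poly m (lambda : 'I_m -> C) z (L : R) :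
  (forall j, cmod (z - lambda j) <= L) -> cmod (node_poly lambda).[z] <= L ^+ m.
Proof.
move=> zL; rewrite horner_prod cmod_prod -[m in L ^+ m]card_ord -prodr_const.
by apply: ler_prod => j _; rewrite hornerXsubC cmod_ge0 zL.
Qed.

(* The maximum principle is applied to [p * p' * (f_i - r_i)], written without
   denominators so that it is holomorphic across the poles. *)
Lemma node_value_bound (D : set C) (s m : nat)
    (w w' : 'M[C]_(s, m)) (lambda lambda' : 'I_m -> C)
    (h h' : 'I_s -> C -> C) (L eps : R) i j :
  open D -> bounded_set D ->
  (forall z a, closure D z -> D a -> cmod (z - a) <= L) ->
  (forall k, D (lambda k)) -> (forall k, D (lambda' k)) ->
  holomorphic_near (closure D) (h i) -> holomorphic_near (closure D) (h' i) ->
  0 <= eps ->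
  (forall z, frontier D z -> enorm (meromorphic_vec w lambda h z -
                         meromorphic_vec w' lambda' h' z) <= eps) ->
  cmod (node_poly lambda').[lambda j] *
    (cmod (w i j) * cmod (cofactor_poly lambda j).[lambda j]) <=
  L ^+ m * L ^+ m * eps.
Proof.
move=> oD bD DL lD lD' hh hh' eps0 feps.
have L0 : 0 <= L.
  have lc : closure D (lambda j) by exact: subset_closure.
  exact: le_trans (cmod_ge0 _) (DL _ _ lc (lD j)).
pose P := numerator_poly lambda (w i); pose P' := numerator_poly lambda' (w' i).
pose p := node_poly lambda; pose p' := node_poly lambda'.
pose G z := p'.[z] * (P.[z] + p.[z] * h i z) - p.[z] * (P'.[z] + p'.[z] * h' i z).
have Gd z : closure D z -> derivable G z 1.
  move=> Dz; have dp q := derivable_poly q z.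
  have dh := holomorphic_near_derivable hh Dz.
  have dh' := holomorphic_near_derivable hh' Dz.
  have d1 := derivable_mul (dp p') (derivable_add (dp P) (derivable_mul (dp p) dh)).
  have d2 := derivable_mul (dp p) (derivable_add (dp P') (derivable_mul (dp p') dh')).
  exact: (derivable_sub d1 d2).
have Gc : {within closure D, continuous G}.
  apply: continuous_in_subspaceT => z /set_mem /Gd.
  by move=> /derivable_cdiff/cdiff_continuous.
have Gf z : frontier D z -> cmod (G z) <= L ^+ m * L ^+ m * eps.
  (* Since [D] is open, a frontier point lies outside [D] and so differs from every pole; no
     denominator vanishes there. *)
  move=> fz; have [cz /=] := fz; rewrite ((interior_id D).1 oD) => nDz.
  have nl a : D a -> z != a by move=> Da; apply/eqP => za; apply: nDz; rewrite za.
  have -> : G z = p.[z] * p'.[z] * ((meromorphic_vec w lambda h z -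
                         meromorphic_vec w' lambda' h' z) i ord0).
    rewrite /G /P /P' (horner_numerator (w i) (fun k => nl _ (lD k))).
    rewrite (horner_numerator (w' i) (fun k => nl _ (lD' k))).
    rewrite !mxE -/(node_poly lambda) -/(node_poly lambda') -/p -/p'; ring.
  rewrite !cmodM; apply: ler_pM; rewrite ?mulr_ge0 ?cmod_ge0//.
    by apply: ler_pM; rewrite ?cmod_ge0//; apply: cmod_node_poly => k; exact: DL.
  exact: le_trans (cmod_le_enorm _ _) (feps z fz).
have B0 : 0 <= L ^+ m * L ^+ m * eps by rewrite !mulr_ge0 ?exprn_ge0.
have Gd' z : D z -> derivable G z 1 by move=> /subset_closure; exact: Gd.
have := maximum_modulus oD bD B0 Gc Gd' Gf (lD j).
congr (_ <= _); rewrite -!cmodM; congr cmod.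
(* As [p] vanishes at [lambda j], only the product of [p'] and [P] survives in [G]. *)
by rewrite /G /P horner_numerator_node /p node_root; ring.
Qed.

End NodePolynomials.

Theorem theorem3p4 (R : realType) (D J : set (Cplx R)) (s m : nat)
    (w : 'M[Cplx R]_(s, m)) (lambda : 'I_m -> Cplx R)
    (h : 'I_s -> Cplx R -> Cplx R)
    (D_neq0 : D !=set0) (D_domain : domain D)
    (J_jordan : jordan_curve J) (D_enclosed : enclosed_by D J)
    (lambdaD : forall j, D (lambda j))
    (lambda_inj : injective lambda)
    (lambda_pole : forall j, exists i, w i j != 0)
    (h_holo : forall i, holomorphic_near (closure D) (h i)) :
  exists eps0 c : R, [/\ 0 < eps0, 0 < c &
    forall (w' : 'M[Cplx R]_(s, m)) (lambda' : 'I_m -> Cplx R)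
      (h' : 'I_s -> Cplx R -> Cplx R) (eps : R),
      (forall j, D (lambda' j)) ->
      (forall i, holomorphic_near (closure D) (h' i)) ->
      is_max [set enorm (meromorphic_vec w lambda h z -
                         meromorphic_vec w' lambda' h' z) | z in frontier D]
             eps ->
      eps < eps0 ->
      enorm (coef_vec m (node_poly lambda) - coef_vec m (node_poly lambda'))
        <= c * eps].
Proof.
have [oD _] := D_domain; have [bD _] := D_enclosed.
have cD : compact (closure D) by exact: compact_closure_bounded.
have cD0 : closure D !=set0.
  by have [z Dz] := D_neq0; exists z; exact: subset_closure.
have [zL _ HL] := compact_EVT_max cD0 cD (continuous_subspaceT (@continuous_cmod R)).
have czL z : closure D z -> cmod z <= cmod zL by move=> /mem_set /HL.
(* Twice the largest modulus on the closure bounds every factor [z - a] of both node polynomials. *)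
pose L := cmod zL + cmod zL.
have DL z a : closure D z -> D a -> cmod (z - a) <= L.
  move=> Dz Da; apply: le_trans (cmodB _ _) _.
  exact: lerD (czL _ Dz) (czL _ (subset_closure Da)).
pose ix j := xchoose (lambda_pole j).
have wix j : w (ix j) j != 0 by exact: (xchooseP (lambda_pole j)).
pose d j := (cofactor_poly lambda j).[lambda j].
have d0 j : d j != 0 by exact: cofactor_neq0.
(* This is [node_value_bound] solved for the value of the perturbed node polynomial; it involves
   only [D], [w] and [lambda], hence is uniform in the perturbed data. *)
pose K j := L ^+ m * L ^+ m / (cmod (w (ix j) j) * cmod (d j)).
have L0 : 0 <= L by rewrite addr_ge0// cmod_ge0.
have K0 j : 0 <= K j.
  by rewrite mulr_ge0 ?invr_ge0 ?mulr_ge0 ?exprn_ge0 ?cmod_ge0.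
(* The Lagrange formula, taken in modulus and summed over all coefficients, with [K j] in place of
   the value at [lambda j]. *)
pose c := \sum_(k < m.+1) \sum_(j < m) K j / cmod (d j) * cmod (cofactor_poly lambda j)`_k.
have c0 : 0 <= c.
  apply: sumr_ge0 => k _; apply: sumr_ge0 => j _.
  by rewrite mulr_ge0 ?cmod_ge0// divr_ge0 ?cmod_ge0.
(* The constant has to be positive, whereas [c] may be 0, for instance when [m = 0]. *)
exists 1, (c + 1); split => //; first by rewrite ltr_wpDl.
move=> w' lambda' h' eps lD' hh' [[z0 fz0 eps_z0] eps_max] _.
have eps0 : 0 <= eps by rewrite -eps_z0 enorm_ge0.
have feps z : frontier D z -> enorm (meromorphic_vec w lambda h z -
    meromorphic_vec w' lambda' h' z) <= eps.
  by move=> fz; apply: eps_max; exists z.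
have val j : cmod (node_poly lambda').[lambda j] <= K j * eps.
  have := node_value_bound (i := ix j) j oD bD DL lambdaD lD' (h_holo _) (hh' _) eps0 feps.
  rewrite -ler_pdivlMr; last first.
    by apply: mulr_gt0; rewrite cmod_gt0; [exact: wix|exact: d0].
  by rewrite mulrAC.
pose q := node_poly lambda - node_poly lambda'.
have qm : (size q <= m)%N by exact: size_node_polyB.
(* The unperturbed node polynomial vanishes at its own nodes, so [val] bounds the interpolation data
   of [q]. *)
have qval j : q.[lambda j] = - (node_poly lambda').[lambda j].
  by rewrite /q hornerD hornerN /node_poly node_root add0r.
apply: (@le_trans _ _ (c * eps)); last by rewrite ler_wpM2r// lerDl.
apply: le_trans (enorm_le_sum _) _; rewrite mulr_suml; apply: ler_sum => k _.
rewrite !mxE -coefB -/q (lagrange_interpolation lambda_inj qm) coef_sum.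
apply: le_trans (cmod_sum _ _ _) _; rewrite mulr_suml; apply: ler_sum => j _.
rewrite coefZ !cmodM cmodV qval cmodN -/(d j) [X in _ <= X]mulrAC.
by rewrite ler_wpM2r ?cmod_ge0// mulrAC ler_wpM2r ?invr_ge0 ?cmod_ge0.
Qed.
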